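(* Let $\mathfrak g$ be a Lie algebra over a field $\mathbb k$, $X$ its associated binary SD object and $R=R_{\mathfrak g}$ its Yang–Baxter operator. For $\phi\in C^2_{\rm BSD}(X;X)$ let $c_\phi(u\otimes v)=v^{(1)}\otimes\phi(u\otimes v^{(2)})$ and $\Xi^2(\phi)=R^{-1}\circ c_\phi$. Then $\Xi^2$ maps $Z^2_{\rm BSD}(X;X)$ into $Z^2_{\rm YB}(R,\hbar)$ and $B^2_{\rm BSD}(X;X)$ into $B^2_{\rm YB}(R,\hbar)$, inducing a homomorphism $\Xi^2\colon H^2_{\rm BSD}(X;X)\to H^2_{\rm YB}(R,\hbar)$. If moreover $\mathfrak g$ has trivial center, this homomorphism is injective.
   Context: Associated binary SD object: $X=\mathbb k\oplus\mathfrak g$, $\Delta(a,x)=(a,x)\otimes(1,0)+(1,0)\otimes(0,x)$, $q((a,x)\otimes(b,y))=(ab,bx+[x,y])$; Sweedler $\Delta(w)=w^{(1)}\otimes w^{(2)}$; $\tau$ the flip. $R(u\otimes v)=v^{(1)}\otimes q(u\otimes v^{(2)})$; explicitly $R((a,x)\otimes(b,y))=(b,y)\otimes(a,x)+(1,0)\otimes(0,[x,y])$, an invertible solution of the Yang–Baxter equation $(R\otimes\mathbb 1)(\mathbb 1\otimes R)(R\otimes\mathbb 1)=(\mathbb 1\otimes R)(R\otimes\mathbb 1)(\mathbb 1\otimes R)$. BSD cohomology: $C^1_{\rm BSD}$ = linear $f\colon X\to X$ with $\Delta f=(f\otimes\mathbb 1+\mathbb 1\otimes f)\Delta$; $C^2_{\rm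 BSD}$ = linear $\phi\colon X\otimes X\to X$ with $\Delta\phi=(\phi\otimes q+q\otimes\phi)(\mathbb 1\otimes\tau\otimes\mathbb 1)(\Delta\otimes\Delta)$; $\delta^1f(u\otimes v)=f(q(u\otimes v))-q(f(u)\otimes v)-q(u\otimes f(v))$; $\delta^2\phi(u\otimes v\otimes w)=q(\phi(u\otimes v)\otimes w)+\phi(q(u\otimes v)\otimes w)-\phi(q(u\otimes w^{(1)})\otimes q(v\otimes w^{(2)}))-q(\phi(u\otimes w^{(1)})\otimes q(v\otimes w^{(2)}))-q(q(u\otimes w^{(1)})\otimes\phi(v\otimes w^{(2)}))$; $Z^2_{\rm BSD}=C^2\cap\ker\delta^2$, $B^2_{\rm BSD}=\delta^1(C^1)$, $H^2_{\rm BSD}=Z^2/B^2$. Yang–Baxter cohomology (Eisermann): $Z^2_{\rm YB}(R,\hbar)$ is the set of linear $g\colon X\otimes X\to X\otimes X$ such that $R(\mathbb 1+\hbar g)$ (extended to $X\otimes\mathbb k[[\hbar]]/(\hbar^2)$) satisfies the Yang–Baxter equation; $B^2_{\rm YB}(R,\hbar)$ is the set of maps $(f\otimes\mathbb 1+\mathbb 1\otimes f)-R^{-1}(f\otimes\mathbb 1+\mathbb 1\otimes f)R$ for linear $f\colon X\to X$; $H^2_{\rm YB}(R,\hbar)=Z^2_{\rm YB}/B^2_{\rm YB}$. *)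

(* Defs.v *)
From HB Require Import structures.
From mathcomp Require Import all_boot all_order all_algebra.
Set Implicit Arguments. Unset Strict Implicit. Unset Printing Implicit Defensive.
Import Order.TTheory GRing.Theory.
Local Open Scope ring_scope.

Section BSD.
Variables (k : fieldType) (V : lmodType k).

Definition is_lie (br : V -> V -> V) : Prop :=
  [/\ (forall a x y z, br (a *: x + y) z = a *: br x z + br y z),
      (forall a x y z, br z (a *: x + y) = a *: br z x + br z y),
      (forall x, br x x = 0) &
      (forall x y z, br x (br y z) + br y (br z x) + br z (br x y) = 0)].

Definition center_trivial (br : V -> V -> V) : Prop :=
  forall z, (forall x, br z x = 0) -> z = 0.

Definition X : lmodType k := (k^o * V)%type.
Definition eX : X := (1, 0).

(* ---------- the tensor algebra T(X) ----------
   An element of T(X) = (+)_n X^{(x)n} is represented by a formal finite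
   linear combination of words (a word [x1;..;xn] stands for x1 (x) .. (x) xn).
   Two formal sums are equal in T(X) iff every multilinear map out of X^* into
   every k-vector space takes the same value on them (universal property). *)
Definition Tns := seq (k * seq X).
Definition pt (w : seq X) : Tns := [:: (1, w)].
Definition tadd (s t : Tns) : Tns := s ++ t.
Definition tscale (a : k) (s : Tns) : Tns := [seq (a * p.1, p.2) | p <- s].
Definition tneg (s : Tns) : Tns := tscale (-1) s.
Definition tmul (s t : Tns) : Tns := [seq (p.1 * q.1, p.2 ++ q.2) | p <- s, q <- t].

Definition multilin (W : lmodType k) (psi : seq X -> W) : Prop :=
  forall (l r : seq X) (a : k) (x y : X),
    psi (l ++ (a *: x + y) :: r) = a *: psi (l ++ x :: r) + psi (l ++ y :: r).

Definition tev (W : lmodType k) (psi : seq X -> W) (s : Tns) : W :=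
  \sum_(p <- s) p.1 *: psi p.2.

Definition teq (s t : Tns) : Prop :=
  forall (W : lmodType k) (psi : seq X -> W), multilin psi -> tev psi s = tev psi t.

(* ---------- linear operators on tensor powers ----------
   A linear map X^{(x)n} -> T(X) is given by its values on pure tensors
   (words of length n). *)
Definition Op := seq X -> Tns.
Definition tmap (A : Op) (s : Tns) : Tns := flatten [seq tscale p.1 (A p.2) | p <- s].
Definition opcomp (A B : Op) : Op := fun w => tmap A (B w).
Definition opadd (A B : Op) : Op := fun w => tadd (A w) (B w).
Definition opscale (a : k) (A : Op) : Op := fun w => tscale a (A w).
Definition opid : Op := pt.
Definition op_l (A : Op) : Op := fun w => tmul (A (take 2 w)) (pt (drop 2 w)).
Definition op_r (A : Op) : Op := fun w => tmul (pt (take 1 w)) (A (drop 1 w)).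
Definition opeq (n : nat) (A B : Op) : Prop :=
  forall w : seq X, size w = n -> teq (A w) (B w).
Definition oplin (n : nat) (A : Op) : Prop :=
  forall (l r : seq X) (a : k) (x y : X), (size l + size r).+1 = n ->
    teq (A (l ++ (a *: x + y) :: r)) (tadd (tscale a (A (l ++ x :: r))) (A (l ++ y :: r))).

Variable br : V -> V -> V.

Definition DeltaX (u : X) : Tns := tadd (pt [:: u; eX]) (pt [:: eX; (0 : k^o, u.2)]).
Definition qX (u v : X) : X := (u.1 * v.1 : k^o, v.1 *: u.2 + br u.2 v.2).
Definition brX (u v : X) : X := (0 : k^o, br u.2 v.2).

Definition Rop : Op := fun w =>
  match w with
  | [:: u; v] => tmap (fun w' => match w' with
                                 | [:: v1; v2] => pt [:: v1; qX u v2]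
                                 | _ => [::] end) (DeltaX v)
  | _ => [::] end.

(* explicit inverse of R: R^{-1}(p (x) q) = q (x) p + [p,q] (x) (1,0);
   that it is the two-sided inverse of R is part of the main theorem *)
Definition Rinv : Op := fun w =>
  match w with
  | [:: p; q] => tadd (pt [:: q; p]) (pt [:: brX p q; eX])
  | _ => [::] end.

Definition lin1 (f : X -> X) : Prop := forall a u v, f (a *: u + v) = a *: f u + f v.
Definition lin2 (phi : X -> X -> X) : Prop :=
  (forall a u v w, phi (a *: u + v) w = a *: phi u w + phi v w) /\
  (forall a u v w, phi w (a *: u + v) = a *: phi w u + phi w v).

Definition C1BSD (f : X -> X) : Prop :=
  lin1 f /\
  forall u, teq (DeltaX (f u))
               (tmap (fun w => match w with
                               | [:: w1; w2] => tadd (pt [:: f w1; w2]) (pt [:: w1; f w2])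
                               | _ => [::] end) (DeltaX u)).

Definition C2BSD (phi : X -> X -> X) : Prop :=
  lin2 phi /\
  forall u v, teq (DeltaX (phi u v))
    (tmap (fun w => match w with
                    | [:: u1; u2; v1; v2] =>
                        (* (phi (x) q + q (x) phi) o (1 (x) tau (x) 1) *)
                        tadd (pt [:: phi u1 v1; qX u2 v2]) (pt [:: qX u1 v1; phi u2 v2])
                    | _ => [::] end)
          (tmul (DeltaX u) (DeltaX v))).

Definition delta1 (f : X -> X) (u v : X) : X :=
  f (qX u v) - qX (f u) v - qX u (f v).

Definition swsum (F : X -> X -> X) (s : Tns) : X :=
  \sum_(p <- s) p.1 *: (match p.2 with [:: a; b] => F a b | _ => 0 end).

Definition delta2 (phi : X -> X -> X) (u v w : X) : X :=
  qX (phi u v) w + phi (qX u v) w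
  - swsum (fun w1 w2 => phi (qX u w1) (qX v w2)) (DeltaX w)
  - swsum (fun w1 w2 => qX (phi u w1) (qX v w2)) (DeltaX w)
  - swsum (fun w1 w2 => qX (qX u w1) (phi v w2)) (DeltaX w).

Definition Z2BSD (phi : X -> X -> X) : Prop :=
  C2BSD phi /\ forall u v w, delta2 phi u v w = 0.

Definition B2BSD (phi : X -> X -> X) : Prop :=
  exists f, C1BSD f /\ forall u v, phi u v = delta1 f u v.

(* ---------- Yang-Baxter cohomology (Eisermann) ----------
   A k[h]/(h^2)-linear endomorphism of (X (x) k[h]/(h^2))^{(x)n} is A0 + h A1
   with A0, A1 k-linear endomorphisms of X^{(x)n}; it is represented by the
   pair (A0, A1). *)
Definition DOp := (Op * Op)%type.
Definition dcomp (A B : DOp) : DOp :=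
  (opcomp A.1 B.1, opadd (opcomp A.1 B.2) (opcomp A.2 B.1)).
Definition dl (A : DOp) : DOp := (op_l A.1, op_l A.2).
Definition dr (A : DOp) : DOp := (op_r A.1, op_r A.2).
Definition deq (n : nat) (A B : DOp) : Prop := opeq n A.1 B.1 /\ opeq n A.2 B.2.

Definition YBE_d (S : DOp) : Prop :=
  deq 3 (dcomp (dl S) (dcomp (dr S) (dl S))) (dcomp (dr S) (dcomp (dl S) (dr S))).

(* R (1 + h g) = R + h (R o g) *)
Definition Z2YB (g : Op) : Prop :=
  oplin 2 g /\ YBE_d (Rop, opcomp Rop g).

Definition f_id_plus_id_f (f : X -> X) : Op := fun w =>
  match w with
  | [:: u; v] => tadd (pt [:: f u; v]) (pt [:: u; f v])
  | _ => [::] end.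

Definition B2YB (g : Op) : Prop :=
  exists f : X -> X, lin1 f /\
    opeq 2 g (opadd (f_id_plus_id_f f)
                    (opscale (-1) (opcomp Rinv (opcomp (f_id_plus_id_f f) Rop)))).

Definition c_phi (phi : X -> X -> X) : Op := fun w =>
  match w with
  | [:: u; v] => tmap (fun w' => match w' with
                                 | [:: v1; v2] => pt [:: v1; phi u v2]
                                 | _ => [::] end) (DeltaX v)
  | _ => [::] end.

Definition Xi2 (phi : X -> X -> X) : Op := opcomp Rinv (c_phi phi).

End BSD.

(* Main.v *)
Require Import Defs.
From HB Require Import structures.
From mathcomp Require Import all_boot all_order all_algebra.
From mathcomp Require boolp classical_sets.
Set Implicit Arguments. Unset Strict Implicit. Unset Printing Implicit Defensive.
Import GRing.Theory.
Local Open Scope ring_scope.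

(** Write [e = (1,0)], [B (a,x) (b,y) = (0,[x,y])] and [bar (a,x) = (0,x)], so that
    [q(u,v) = v.1 u + B u v] and [c_phi(u,v) = v (x) phi(u,e) + e (x) phi(u,bar v)].
    Equality of tensors is tested against multilinear maps.  The coderivation
    condition on a cochain forces its values into the Lie algebra, and forces
    [x (x) eta + eta (x) x = 0] for all [x], where [eta] is [phi(e,v)] or [f(e)];
    hence either [eta = 0] or the Lie algebra is a line and the bracket vanishes.
    With these degenerate terms gone, the cocycle condition yields
    [B u (phi(v,e)) = 0] and [phi(B u w, e) = B (phi(u,e)) w], and the first-order
    Yang-Baxter equation reduces to the cocycle condition on barred arguments.
    The BSD coboundary of [f] is sent to the Yang-Baxter coboundary of [-f].
    Conversely, if [Xi2 phi] is the coboundary of [F] and the center is trivial,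
    then [phi(u,e) = B u (F e)] vanishes, [F e = alpha e], and [phi] is the BSD
    coboundary of [u |-> alpha (bar u) - bar (F (bar u))]. *)

(** * Identities in abelian groups by reflection *)

Section AbelianGroupReflection.

Inductive zexpr := ZVar of nat | ZZero | ZAdd of zexpr & zexpr | ZOpp of zexpr.

Variable W : zmodType.

Fixpoint zdenote (env : seq W) (t : zexpr) : W :=
  match t with
  | ZVar n => env`_n
  | ZZero => 0
  | ZAdd t1 t2 => zdenote env t1 + zdenote env t2
  | ZOpp t1 => - zdenote env t1
  end.

Fixpoint zcoef (t : zexpr) (i : nat) : int :=
  match t with
  | ZVar n => (n == i)%:Z
  | ZZero => 0
  | ZAdd t1 t2 => zcoef t1 i + zcoef t2 i
  | ZOpp t1 => - zcoef t1 i
  end.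

(** A variable beyond [env] denotes 0 by the default of [nth], so summing over the indices of [env]
    loses nothing. *)
Lemma zdenoteE env t :
  zdenote env t = \sum_(i < size env) env`_i *~ zcoef t i.
Proof.
elim: t => [n||t1 IH1 t2 IH2|t IH] /=.
- have [lt_n|ge_n] := ltnP n (size env).
    rewrite (bigD1 (Ordinal lt_n)) //= eqxx big1 ?addr0 // => i.
    by rewrite -val_eqE /= eq_sym => /negPf ->.
  rewrite nth_default // big1 // => i _.
  by rewrite gtn_eqF ?(leq_trans (ltn_ord i)).
- by rewrite big1.
- by rewrite IH1 IH2 -big_split; apply: eq_bigr => i _; rewrite mulrzDr.
- by rewrite IH -sumrN; apply: eq_bigr => i _; rewrite mulrNz.
Qed.

Lemma zdenote_eq env t1 t2 :
  all (fun i => zcoef t1 i == zcoef t2 i) (iota 0 (size env)) ->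
  zdenote env t1 = zdenote env t2.
Proof.
move=> /allP eq12; rewrite !zdenoteE; apply: eq_bigr => i _.
by rewrite (eqP (eq12 _ _)) // mem_iota ltn_ord.
Qed.

End AbelianGroupReflection.

(* Atoms are compared up to conversion: [X V] and [k^o * V] both occur. *)
Ltac atom_index x env :=
  match env with
  | ?y :: _ => let _ := match goal with _ => unify x y end in constr:(0%N)
  | _ :: ?env' => let n := atom_index x env' in constr:(n.+1)
  end.

Ltac collect_atoms t env :=
  lazymatch t with
  | (?a + ?b)%R => let env' := collect_atoms a env in collect_atoms b env'
  | (- ?a)%R => collect_atoms a env
  | 0%R => env
  | _ => match env with
         | _ => let n := atom_index t env in env
         | _ => constr:(t :: env)
         end
  end.

Ltac reify_zexpr t env :=
  lazymatch t with
  | (?a + ?b)%R => let a' := reify_zexpr a env in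
                   let b' := reify_zexpr b env in constr:(ZAdd a' b')
  | (- ?a)%R => let a' := reify_zexpr a env in constr:(ZOpp a')
  | 0%R => constr:(ZZero)
  | _ => let n := atom_index t env in constr:(ZVar n)
  end.

Ltac abel :=
  lazymatch goal with
  | |- @eq ?T ?a ?b =>
    let env0 := collect_atoms a (@nil T) in
    let env := collect_atoms b env0 in
    let a' := reify_zexpr a env in
    let b' := reify_zexpr b env in
    apply: (@zdenote_eq _ env a' b'); vm_compute; reflexivity
  end.

(** * Linear functionals on arbitrary vector spaces *)

Section LinearFunctionals.
Import boolp classical_sets.

(* A subspace maximal among those avoiding [b] is a hyperplane complementary
   to the line through [b]; the functional reads off the [b]-coordinate. *)
Lemma exists_linear_functional (k : fieldType) (V : lmodType k) (b : V) :
  b <> 0 ->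
  exists f : V -> k,
    (forall a x y, f (a *: x + y) = a * f x + f y) /\ f b = 1.
Proof.
move=> nz_b.
pose closed_comb (M : set V) := forall a x y, M x -> M y -> M (a *: x + y).
pose P : set (set V) := fun M => closed_comb M /\ ~ M b.
have [|M [[clM Mb] maxM]] := @Zorn_bigcup V P.
  move=> F FP totF; split; last by move=> [A FA Ab]; case: (FP _ FA).
  move=> a x y [A FA Ax] [B FB By].
  by case: (totF _ _ FA FB) => sub;
    [exists B => //; apply: (FP _ FB).1 => //; apply: sub
    |exists A => //; apply: (FP _ FA).1 => //; apply: sub].
have M0 : M 0.
  apply: contrapT => nM0.
  (* The empty set satisfies [closed_comb], so 0 in [M] comes from maximality: otherwise 0 could be
     adjoined. *)
  apply: (maxM (fun x => M x \/ x = 0)).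
    by split; [move=> x; left | move=> /(_ 0 (or_intror erefl))].
  split=> [a x y [Mx|->] [My|->]|[//|/nz_b//]].
  - by left; apply: clM.
  (* While 0 in [M] is unknown, [a *: x] is reached as [(a - 1) *: x + x]. *)
  - left; rewrite addr0; have Mxx := clM (a - 1) _ _ Mx Mx.
    by move: Mxx; rewrite -[X in _ + X]scale1r -scalerDl subrK.
  - by left; rewrite scaler0 add0r.
  - by right; rewrite scaler0 add0r.
have clZ a x : M x -> M (a *: x) by move=> Mx; rewrite -[_ *: _]addr0; apply: clM.
have decomp x : exists c : k, M (x - c *: b).
  apply: contrapT => nx.
  have nMx : ~ M x by move=> Mx; apply: nx; exists 0; rewrite scale0r subr0.
  (* The competitor is M + kx. If it contained b = m + cx, then c would be nonzero and x - b/c =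
     -m/c would lie in M. *)
  apply: (maxM (fun y => exists c m, M m /\ y = m + c *: x)).
    split=> [y My|sub]; first by exists 0, y; rewrite scale0r addr0.
    by apply/nMx/sub; exists 1, 0; rewrite scale1r add0r.
  split=> [a y z [c [m [Mm ->]]] [d [n [Mn ->]]]|[c [m [Mm bE]]]].
    exists (a * c + d), (a *: m + n); split; first exact: clM.
    by rewrite scalerDl scalerDr scalerA addrACA.
  have nz_c : c != 0.
    by apply/eqP => c0; apply: Mb; rewrite bE c0 scale0r addr0.
  apply: nx; exists c^-1.
  rewrite bE scalerDr scalerA mulVf // scale1r opprD addrCA subrr addr0.
  by rewrite -scalerN -scaleN1r; apply/clZ/clZ.
pose f x := projT1 (cid (decomp x)).
have fP x : M (x - f x *: b) by rewrite /f; case: cid.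
have funiq x c : M (x - c *: b) -> f x = c.
  move=> Mxc; apply: contrapT => /eqP; rewrite -subr_eq0 => nz.
  apply: Mb; rewrite -[b]scale1r -(mulVf nz) -scalerA; apply: clZ.
  have := clM (-1) _ _ (fP x) Mxc; rewrite scaleN1r.
  by rewrite opprB addrA subrK -scalerBl.
exists f; split=> [a x y|]; last by apply: funiq; rewrite scale1r subrr.
apply: funiq.
have -> : a *: x + y - (a * f x + f y) *: b = a *: (x - f x *: b) + (y - f y *: b).
  by rewrite scalerDl scalerBr scalerA opprD addrACA.
exact: clM.
Qed.

End LinearFunctionals.

(** * Evaluation of formal tensors against multilinear maps *)

Section Tensors.
Variables (k : fieldType) (V : lmodType k).
Implicit Types (W : lmodType k) (s t : Tns V) (A B : Op V) (w l r : seq (X V)).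

Lemma tev_nil W (psi : seq (X V) -> W) : tev psi [::] = 0.
Proof. exact: big_nil. Qed.

Lemma tev_cons W (psi : seq (X V) -> W) p s :
  tev psi (p :: s) = p.1 *: psi p.2 + tev psi s.
Proof. exact: big_cons. Qed.

Lemma tev_pt W (psi : seq (X V) -> W) w : tev psi (pt w) = psi w.
Proof. by rewrite tev_cons tev_nil scale1r addr0. Qed.

Lemma tev_add W (psi : seq (X V) -> W) s t :
  tev psi (tadd s t) = tev psi s + tev psi t.
Proof. exact: big_cat. Qed.

Lemma tev_scale W (psi : seq (X V) -> W) a s :
  tev psi (tscale a s) = a *: tev psi s.
Proof.
rewrite /tev big_map scaler_sumr; apply: eq_bigr => p _.
by rewrite scalerA.
Qed.

Lemma tev_map W (psi : seq (X V) -> W) A s :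
  tev psi (tmap A s) = tev (fun w => tev psi (A w)) s.
Proof.
rewrite /tmap; elim: s => [|p s IH] /=; first by rewrite !tev_nil.
by rewrite tev_add IH tev_cons tev_scale.
Qed.

Lemma tev_comp W (psi : seq (X V) -> W) A B w :
  tev psi (opcomp A B w) = tev (fun w => tev psi (A w)) (B w).
Proof. exact: tev_map. Qed.

Lemma tev_mulr W (psi : seq (X V) -> W) s r :
  tev psi (tmul s (pt r)) = tev (fun w => psi (w ++ r)) s.
Proof.
elim: s => [|p s IH]; first by rewrite !tev_nil.
by rewrite [tmul _ _]/= !tev_cons -IH /= mulr1.
Qed.

Lemma tev_mull W (psi : seq (X V) -> W) s l :
  tev psi (tmul (pt l) s) = tev (fun w => psi (l ++ w)) s.
Proof.
rewrite /tmul /= cats0; elim: s => [|p s IH]; first by rewrite !tev_nil.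
by rewrite /= !tev_cons -IH /= mul1r.
Qed.

Lemma tev_op_l W (psi : seq (X V) -> W) A w :
  tev psi (op_l A w) = tev (fun z => psi (z ++ drop 2 w)) (A (take 2 w)).
Proof. exact: tev_mulr. Qed.

Lemma tev_op_r W (psi : seq (X V) -> W) A w :
  tev psi (op_r A w) = tev (fun z => psi (take 1 w ++ z)) (A (drop 1 w)).
Proof. exact: tev_mull. Qed.

Lemma tev_lin W (psi1 psi2 psi3 : seq (X V) -> W) a s :
  (forall w, psi1 w = a *: psi2 w + psi3 w) ->
  tev psi1 s = a *: tev psi2 s + tev psi3 s.
Proof.
move=> E; rewrite /tev scaler_sumr -big_split; apply: eq_bigr => p _ /=.
by rewrite E scalerDr !scalerA mulrC.
Qed.

Section Multilinear.
Variables (W : lmodType k) (psi : seq (X V) -> W).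
Hypothesis psi_lin : multilin psi.

Lemma multilin0 l r : psi (l ++ 0 :: r) = 0.
Proof.
have := psi_lin l r (-1) 0 0.
by rewrite scaler0 addr0 scaleN1r addNr.
Qed.

Lemma multilinD l r x y : psi (l ++ (x + y) :: r) = psi (l ++ x :: r) + psi (l ++ y :: r).
Proof. by have := psi_lin l r 1 x y; rewrite !scale1r. Qed.

Lemma multilinZ l r a x : psi (l ++ (a *: x) :: r) = a *: psi (l ++ x :: r).
Proof. by have := psi_lin l r a x 0; rewrite multilin0 !addr0. Qed.

Lemma multilinN l r x : psi (l ++ (- x) :: r) = - psi (l ++ x :: r).
Proof. by rewrite -scaleN1r multilinZ scaleN1r. Qed.

Lemma multilin_cat l r : multilin (fun w => psi (l ++ w ++ r)).
Proof. by move=> l' r' a x y; rewrite -!catA !cat_cons !(catA l); exact: psi_lin. Qed.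

Lemma multilin_catr r : multilin (fun w => psi (w ++ r)).
Proof. exact: (multilin_cat [::]). Qed.

Lemma multilin_catl l : multilin (fun w => psi (l ++ w)).
Proof.
by move=> l' r' a x y; rewrite !(catA l); exact: psi_lin.
Qed.

End Multilinear.

(** Linearity in dual form: free of any word length, it passes through composition, [op_l] and
    [op_r], and it implies [oplin]. *)
Definition multilin_op A : Prop :=
  forall W (psi : seq (X V) -> W), multilin psi -> multilin (fun w => tev psi (A w)).

Lemma multilin_op_oplin n A : multilin_op A -> oplin n A.
Proof.
by move=> linA l r a x y _ W psi psi_lin; rewrite tev_add tev_scale linA.
Qed.

Lemma multilin_op_comp A B : multilin_op A -> multilin_op B -> multilin_op (opcomp A B).
Proof.
move=> linA linB W psi psi_lin l r a x y; rewrite !tev_comp.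
exact: linB _ _ (linA _ _ psi_lin) l r a x y.
Qed.

(** A varying letter among the first two is handled by linearity of [A]; a later one is not touched
    by [A], and linearity of [psi] suffices. *)
Lemma multilin_op_l A : multilin_op A -> multilin_op (op_l A).
Proof.
move=> linA W psi psi_lin l r a x y; rewrite !tev_op_l.
case: l => [|p [|q l]].
- exact: linA _ _ (multilin_catr psi_lin (drop 1 r)) [::] (take 1 r) a x y.
- rewrite /= !take0 !drop0.
  exact: linA _ _ (multilin_catr psi_lin r) [:: p] [::] a x y.
- rewrite /= !take0 !drop0; apply: tev_lin => w.
  by rewrite !catA; exact: psi_lin.
Qed.

Lemma multilin_op_r A : multilin_op A -> multilin_op (op_r A).
Proof.
move=> linA W psi psi_lin l r a x y; rewrite !tev_op_r.
case: l => [|p l].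
- rewrite /= !take0 !drop0; apply: tev_lin => w.
  exact: (psi_lin [::]).
- rewrite /= !take0 !drop0.
  exact: linA _ _ (multilin_catl psi_lin [:: p]) l r a x y.
Qed.

(** Extension by zero keeps multilinearity, since [multilin] only relates words of equal length;
    bilinear maps thus become test maps. *)
Definition word2 W (beta : X V -> X V -> W) w : W :=
  if w is [:: u; v] then beta u v else 0.

Lemma multilin_word2 W (beta : X V -> X V -> W) :
  (forall a u v z, beta (a *: u + v) z = a *: beta u z + beta v z) ->
  (forall a u v z, beta z (a *: u + v) = a *: beta z u + beta z v) ->
  multilin (word2 beta).
Proof.
move=> linl linr l r a x y.
case: l => [|p [|q [|? l]]] /=; case: r => [|c [|d r]] //=;
  rewrite ?linl ?linr ?scaler0 ?addr0 //.
Qed.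

Lemma multilin_op_word2 A :
  (forall w, size w <> 2 -> A w = [::]) ->
  (forall W (psi : seq (X V) -> W) a x y z, multilin psi ->
     tev psi (A [:: a *: x + y; z])
       = a *: tev psi (A [:: x; z]) + tev psi (A [:: y; z]) /\
     tev psi (A [:: z; a *: x + y])
       = a *: tev psi (A [:: z; x]) + tev psi (A [:: z; y])) ->
  multilin_op A.
Proof.
move=> A0 linA W psi psi_lin l r a x y.
have [sz2|/eqP sz2] := eqVneq (size l + size r).+1 2.
  case: l r sz2 => [|p [|? ?]] [|q [|? ?]] //= _.
    by have [] := linA _ psi a x y q psi_lin.
  by have [] := linA _ psi a x y p psi_lin.
rewrite !A0 ?size_cat ?addnS //.
by rewrite !tev_nil scaler0 addr0.
Qed.

End Tensors.

(** * The Lie bracket on X, the operator R and its inverse *)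

Section BSDComplex.
Variables (k : fieldType) (V : lmodType k) (br : V -> V -> V).
Hypothesis br_lie : is_lie br.

Notation e := (eX V).
Notation B := (brX br).
Implicit Types (u v w : X V) (phi : X V -> X V -> X V) (f : X V -> X V).

Definition bar u : X V := (0 : k^o, u.2).

Lemma X_eq u v : u.1 = v.1 -> u.2 = v.2 -> u = v.
Proof. by case: u v => [a x] [b y] /= -> ->. Qed.

Lemma brX_linl a u v w : B (a *: u + v) w = a *: B u w + B v w.
Proof. by case: br_lie => H _ _ _; apply: X_eq; rewrite /= ?H // scaler0 addr0. Qed.

Lemma brX_linr a u v w : B w (a *: u + v) = a *: B w u + B w v.
Proof. by case: br_lie => _ H _ _; apply: X_eq; rewrite /= ?H // scaler0 addr0. Qed.

Lemma br_linear_sides :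
  (forall y, br 0 y = 0) /\ (forall y, br y 0 = 0).
Proof.
case: br_lie => Hl Hr _ _; split=> y.
  by have := Hl (-1) 0 0 y; rewrite scaler0 addr0 scaleN1r addNr.
by have := Hr (-1) 0 0 y; rewrite scaler0 addr0 scaleN1r addNr.
Qed.

Lemma br0l y : br 0 y = 0. Proof. exact: br_linear_sides.1. Qed.
Lemma br0r y : br y 0 = 0. Proof. exact: br_linear_sides.2. Qed.

Lemma br_antisym x y : br y x = - br x y.
Proof.
case: br_lie => Hl Hr H0 _; apply/eqP; rewrite -addr_eq0 addrC.
have := H0 (1 *: x + y); rewrite Hl !Hr !H0 !scale1r add0r addr0.
by move=> ->.
Qed.

Lemma brNr x y : br x (- y) = - br x y.
Proof.
case: br_lie => _ Hr _ _.
by have := Hr (-1) y 0 x; rewrite br0r !addr0 !scaleN1r.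
Qed.

Lemma brX_antisym u v : B v u = - B u v.
Proof. by apply: X_eq; rewrite /= ?oppr0 // br_antisym. Qed.

(** The Jacobi identity in the form that bracketing with [w] on the right is a derivation. *)
Lemma brX_jacobi u v w : B (B u v) w = B (B u w) v + B u (B v w).
Proof.
case: br_lie => _ _ _ J; apply: X_eq; rewrite /= ?addr0 //.
move: {u v w} u.2 v.2 w.2 => x y z.
have := J x y z; rewrite (br_antisym x z) brNr.
rewrite -(br_antisym y (br x z)) -[br z _]opprK -(br_antisym z (br x y)).
by move/subr0_eq <-; abel.
Qed.

Lemma brXe u : B u e = 0. Proof. by apply: X_eq; rewrite //= br0r. Qed.
Lemma breX u : B e u = 0. Proof. by apply: X_eq; rewrite //= br0l. Qed.

Lemma brX0 u : B u 0 = 0. Proof. by apply: X_eq; rewrite //= br0r. Qed.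
Lemma br0X u : B 0 u = 0. Proof. by apply: X_eq; rewrite //= br0l. Qed.

Lemma brXN u v : B u (- v) = - B u v.
Proof. by apply: X_eq; rewrite /= ?oppr0 // brNr. Qed.

Lemma brNX u v : B (- u) v = - B u v.
Proof. by rewrite brX_antisym brXN -brX_antisym. Qed.

Lemma qXE u v : qX br u v = v.1 *: u + B u v.
Proof. by apply: X_eq; rewrite //= addr0 mulrC. Qed.

Lemma qXe u : qX br u e = u.
Proof. by rewrite qXE brXe addr0 scale1r. Qed.

Lemma qX_bar u v : qX br u (bar v) = B u v.
Proof. by rewrite qXE scale0r add0r. Qed.

Lemma bar_decomp u : u = u.1 *: e + bar u.
Proof. by apply: X_eq; rewrite /= ?addr0 ?scaler0 ?add0r // /GRing.scale /= mulr1. Qed.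

Lemma bar_e : bar e = 0. Proof. by []. Qed.

Lemma bar_id u : u.1 = 0 -> bar u = u.
Proof. by move=> u0; apply: X_eq. Qed.

Section TensorFormulas.
Variables (W : lmodType k) (psi : seq (X V) -> W).

Lemma tev_Rop u v : tev psi (Rop br [:: u; v]) = psi [:: v; u] + psi [:: e; B u v].
Proof.
by rewrite tev_map tev_add !tev_pt qXe qX_bar.
Qed.

Lemma tev_Rinv u v : tev psi (Rinv br [:: u; v]) = psi [:: v; u] + psi [:: B u v; e].
Proof. by rewrite tev_add !tev_pt. Qed.

Lemma tev_c_phi phi u v :
  tev psi (c_phi phi [:: u; v]) = psi [:: v; phi u e] + psi [:: e; phi u (bar v)].
Proof. by rewrite tev_map tev_add !tev_pt. Qed.

Lemma tev_leibniz f u v :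
  tev psi (f_id_plus_id_f f [:: u; v]) = psi [:: f u; v] + psi [:: u; f v].
Proof. by rewrite tev_add !tev_pt. Qed.

End TensorFormulas.

Lemma multilin_op_Rop : multilin_op (Rop br).
Proof.
apply: multilin_op_word2 => [[|? [|? []]] //|W psi a x y z psi_lin].
rewrite !tev_Rop brX_linl brX_linr.
have H l r := psi_lin l r a; split.
  rewrite (H [:: z] [::]) (H [:: e] [::]) /=.
  by rewrite scalerDr addrACA.
by rewrite (H [::] [:: z]) (H [:: e] [::]) /= scalerDr addrACA.
Qed.

Lemma multilin_op_Rinv : multilin_op (Rinv br).
Proof.
apply: multilin_op_word2 => [[|? [|? []]] //|W psi a x y z psi_lin].
rewrite !tev_Rinv brX_linl brX_linr.
have H l r := psi_lin l r a; split.
  by rewrite (H [:: z] [::]) (H [::] [:: e]) /= scalerDr addrACA.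
by rewrite (H [::] [:: z]) (H [::] [:: e]) /= scalerDr addrACA.
Qed.

Lemma multilin_op_c_phi phi : lin2 phi -> multilin_op (c_phi phi).
Proof.
move=> [linl linr].
apply: multilin_op_word2 => [[|? [|? []]] //|W psi a x y z psi_lin].
have H l r := psi_lin l r a; rewrite !tev_c_phi; split.
  by rewrite !linl (H [:: z] [::]) (H [:: e] [::]) /= scalerDr addrACA.
have -> : bar (a *: x + y) = a *: bar x + bar y.
  by apply: X_eq; rewrite //= scaler0 addr0.
by rewrite linr (H [::] [:: _]) (H [:: e] [::]) /= scalerDr addrACA.
Qed.

Lemma Rop_Rinv : opeq 2 (opcomp (Rop br) (Rinv br)) (@opid k V).
Proof.
move=> [|u [|v []]] // _ W psi psi_lin.
rewrite tev_comp tev_Rinv !tev_Rop tev_pt brX_antisym brXe.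
rewrite (multilinN psi_lin [:: e] [::]) (multilin0 psi_lin [:: e] [::]) /=.
by abel.
Qed.

Lemma Rinv_Rop : opeq 2 (opcomp (Rinv br) (Rop br)) (@opid k V).
Proof.
move=> [|u [|v []]] // _ W psi psi_lin.
rewrite tev_comp tev_Rop !tev_Rinv tev_pt (brX_antisym u v) breX.
rewrite (multilinN psi_lin [::] [:: e]) (multilin0 psi_lin [::] [:: e]) /=.
by abel.
Qed.

(** This contraction sends e ⊗ x to x and kills bar u ⊗ x, turning tensor identities into identities
    in X. *)
Lemma multilin_fst_tensor : multilin (word2 (fun u v => u.1 *: v)).
Proof.
apply: multilin_word2 => a u v z /=; first by rewrite scalerDl scalerA.
by rewrite scalerDr !scalerA mulrC.
Qed.

Section SndTensor.
Variable h : V -> k.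
Hypothesis h_lin : forall a x y, h (a *: x + y) = a * h x + h y.

Lemma functional0 : h 0 = 0.
Proof. by have := h_lin (-1) 0 0; rewrite scaler0 addr0 mulN1r addNr. Qed.

(** This contraction kills e ⊗ x, which isolates the skew terms of the coderivation condition. *)
Lemma multilin_snd_tensor : multilin (word2 (fun u v => h u.2 *: v.2)).
Proof.
apply: multilin_word2 => a u v z /=; first by rewrite h_lin scalerDl scalerA.
by rewrite scalerDr !scalerA mulrC.
Qed.

End SndTensor.

(* If [x (x) eta + eta (x) x = 0] for all [x] and [eta] is nonzero, then the
   Lie algebra is the line spanned by [eta], hence abelian. *)
Lemma skew_tensor_dichotomy (eta : V) :
  (forall h : V -> k, (forall a x y, h (a *: x + y) = a * h x + h y) ->
     forall x, h x *: eta + h eta *: x = 0) ->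
  forall x y, br x y = 0 \/ eta = 0.
Proof.
move=> skew x y; have [->|/eqP nz] := eqVneq eta 0; [by right | left].
have [h [h_lin h1]] := exists_linear_functional nz.
have line z : z = (- h z) *: eta + 0.
  apply/eqP; rewrite addr0 scaleNr -addr_eq0 addrC.
  by rewrite -[z in _ + z]scale1r -h1 skew.
case: br_lie => Hl Hr H0 _.
by rewrite (line x) (line y) Hl Hr H0 br0r br0l !(scaler0, addr0).
Qed.

(** * BSD 2-cochains and 2-cocycles *)

Section TwoCochains.
Variable phi : X V -> X V -> X V.
Hypothesis phiC : C2BSD br phi.

Let linl : forall a u v w, phi (a *: u + v) w = a *: phi u w + phi v w.
Proof. exact: phiC.1.1. Qed.

Let linr : forall a u v w, phi w (a *: u + v) = a *: phi w u + phi w v.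
Proof. exact: phiC.1.2. Qed.

Lemma cochain0l u : phi 0 u = 0.
Proof. by have := linl (-1) 0 0 u; rewrite scaler0 addr0 scaleN1r addNr. Qed.

Lemma cochain0r u : phi u 0 = 0.
Proof. by have := linr (-1) 0 0 u; rewrite scaler0 addr0 scaleN1r addNr. Qed.

Lemma qe_bar v : qX br e (bar v) = 0.
Proof. by rewrite qX_bar breX. Qed.

Lemma cochain_decompr u v : phi u v = v.1 *: phi u e + phi u (bar v).
Proof. by rewrite -linr -bar_decomp. Qed.

Lemma cochain_decompl u v : phi u v = u.1 *: phi e v + phi (bar u) v.
Proof. by rewrite -linl -bar_decomp. Qed.

(** The two sides of the coderivation condition share φ(u,v) ⊗ e; this is what remains after
    cancelling it. *)
Lemma coderivation_tev (W : lmodType k) (psi : seq (X V) -> W) u v :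
  multilin psi ->
  psi [:: e; bar (phi u v)] =
    psi [:: qX br u v; phi e e] + psi [:: u; phi e (bar v)] +
    psi [:: phi e v; bar u] + v.1 *: psi [:: e; phi (bar u) e] +
    psi [:: phi e e; B u v] + psi [:: e; phi (bar u) (bar v)].
Proof.
move=> psi_lin; have := phiC.2 u v _ psi psi_lin.
rewrite tev_map tev_add !tev_pt /tmul /= !tev_cons !tev_nil /=.
rewrite !mul1r !scale1r !addr0.
rewrite -!/(bar _) !qXe qe_bar qX_bar (qXE e v) breX addr0.
rewrite (multilin0 psi_lin [:: _] [::]) (multilinZ psi_lin [::] [:: _]) /=.
rewrite -!addrA => /addrI ->.
by rewrite /bar /brX /=; abel.
Qed.

Lemma cochain_fst u v : (phi u v).1 = 0.
Proof.
(* The scalar part of the left side is 0. The choices (e,e), then (e,q), then general (p,q) kill the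
   scalar parts on the right one after another. *)
have key p q : bar (phi p q) =
    (p.1 * q.1) *: phi e e + p.1 *: phi e (bar q) + (phi e q).1 *: bar p +
    q.1 *: phi (bar p) e + (phi e e).1 *: B p q + phi (bar p) (bar q).
  by have := coderivation_tev p q multilin_fst_tensor; rewrite /= !scale1r.
have xi0 : (phi e e).1 = 0.
  have := congr1 fst (key e e); rewrite bar_e brXe !cochain0r cochain0l /=.
  by rewrite !(mul1r, mulr0, scaler0, scale1r, addr0) => <-.
have phie0 q : (phi e (bar q)).1 = 0.
  have := congr1 fst (key e q); rewrite bar_e breX !cochain0l /=.
  by rewrite xi0 /= !(mulr0, mul1r, scale1r, scaler0, addr0, add0r) => <-.
have phie q : (phi e q).1 = 0.
  by rewrite cochain_decompr /= xi0 phie0 scaler0 addr0.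
have bar1 p q : q.1 *: (phi (bar p) e).1 + (phi (bar p) (bar q)).1 = 0.
  have := congr1 fst (key p q).
  rewrite /= xi0 !phie /= !(scale0r, scaler0, add0r, addr0).
  by move <-.
rewrite cochain_decompl /= phie scaler0 add0r cochain_decompr /=.
exact: bar1.
Qed.

Lemma cochain_e_dichotomy x y v : br x y = 0 \/ phi e v = 0.
Proof.
have key h (h_lin : forall a x y, h (a *: x + y) = a * h x + h y) (p q : X V) : 0 =
    h (q.1 *: p.2 + br p.2 q.2) *: (phi e e).2 + h p.2 *: (phi e (bar q)).2 +
    h (phi e q).2 *: p.2 + h (phi e e).2 *: br p.2 q.2.
  have := coderivation_tev p q (multilin_snd_tensor h_lin).
  by rewrite /= (functional0 h_lin) !(scale0r, scaler0, addr0).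
have [|xi0] : br x y = 0 \/ (phi e e).2 = 0; [|by left|].
  apply: skew_tensor_dichotomy => h h_lin z.
  (* With second argument [e] every bracket vanishes, and only the skew tensor in z and φ(e,e)
     survives. *)
  have := key h h_lin (0, z) e; rewrite bar_e !cochain0r /= br0r.
  by rewrite !(scale1r, scaler0, addr0) => <-.
have phiee : phi e e = 0 by apply: X_eq; rewrite ?cochain_fst.
have [|eta0] : br x y = 0 \/ (phi e v).2 = 0; [|by left|].
  apply: skew_tensor_dichotomy => h h_lin z.
  have := key h h_lin (0, z) v; rewrite phiee /= (functional0 h_lin).
  rewrite !(scale0r, scaler0, addr0, add0r).
  by rewrite (cochain_decompr e v) phiee scaler0 add0r => <-.
by right; apply: X_eq; rewrite ?cochain_fst.
Qed.

Lemma brX_cochain_e u v w : B u (phi e v) = 0 /\ B (B u w) (phi e v) = 0.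
Proof.
(* The dichotomy is applied to the very bracket in question, so both alternatives annihilate it. *)
have [xy0|->] := cochain_e_dichotomy u.2 (phi e v).2 v; last by rewrite !brX0.
split; first exact: X_eq.
have [xy0'|->] := cochain_e_dichotomy (B u w).2 (phi e v).2 v; last by rewrite !brX0.
exact: X_eq.
Qed.

Lemma tensor_cochain_e (W : lmodType k) (psi : seq (X V) -> W) p u v w :
  multilin psi -> psi [:: p; phi e w; B u v] = 0.
Proof.
move=> psi_lin; have [uv0|->] := cochain_e_dichotomy u.2 v.2 w.
  have -> : B u v = 0 by apply: X_eq.
  exact: (multilin0 psi_lin [:: p; _] [::]).
exact: (multilin0 psi_lin [:: p] [:: _]).
Qed.

Hypothesis phi_cocycle : forall u v w, delta2 br phi u v w = 0.

Lemma cocycle_expanded u v w :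
  B (phi u v) w + phi (B u v) w =
  phi (B u w) v + phi u (B v w) + B (phi u w) v + B (phi u e) (B v w) +
  (w.1 *: B u (phi v e) + B (B u w) (phi v e) + B u (phi v (bar w))).
Proof.
have /eqP := phi_cocycle u v w; rewrite /delta2 /swsum.
rewrite !big_cons !big_nil /= !scale1r !addr0 -!/(bar _) !qXe !qX_bar.
rewrite !subr_eq add0r => /eqP.
rewrite !qXE !linl brX_linl !cochain_fst !scale0r.
(* These scalar multiples, produced by the unit parts of [w] and [v], occur on both sides. *)
move=> eq0; apply: (addrI (w.1 *: phi u v + v.1 *: phi u w)).
transitivity (w.1 *: phi u v + B (phi u v) w + (v.1 *: phi u w + phi (B u v) w)).
  by abel.
by rewrite eq0; abel.
Qed.

(** The cocycle condition at (u, e, w), where all values φ(e, ·) bracket to zero. *)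
Lemma cocycle_brX_e u w : phi (B u w) e = B (phi u e) w.
Proof.
have := cocycle_expanded u e w.
rewrite !breX !brXe cochain0l cochain0r !brX0.
have [-> ->] := brX_cochain_e u e w; have [-> _] := brX_cochain_e u (bar w) w.
by rewrite scaler0 !addr0.
Qed.

(** At (u, v, e) the term φ([u,v],e) = [φ(u,e),v] cancels, so φ( · ,e) takes central values. *)
Lemma brX_cocycle_e u v : B u (phi v e) = 0.
Proof.
have := cocycle_expanded u v e.
rewrite bar_e !brXe br0X !cochain0r cochain0l cocycle_brX_e !brX0.
rewrite scale1r !addr0 !add0r => /eqP.
by rewrite -subr_eq0 opprD addrA subrr sub0r oppr_eq0 => /eqP.
Qed.

(** The condition at (u, bar v, bar w), solved for the term to be eliminated from the e ⊗ e ⊗ X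
    component of the Yang-Baxter equation. *)
Lemma cocycle_bar u v w :
  phi (B u v) (bar w) =
  phi (B u w) (bar v) + phi u (B v w) + B (phi u (bar w)) v +
  B (phi u e) (B v w) + B u (phi v (bar w)) - B (phi u (bar v)) w.
Proof.
have := cocycle_expanded u (bar v) (bar w).
have -> : B u (phi v (bar w)) = B u (phi (bar v) (bar w)).
  rewrite [in LHS](cochain_decompl v) brX_linr.
  by have [-> _] := brX_cochain_e u (bar w) w; rewrite scaler0 add0r.
rewrite !brX_cocycle_e scaler0 !add0r => /(canRL (addKr _)) ->.
by rewrite -!/(bar _) /=; abel.
Qed.

End TwoCochains.

(** * The Yang-Baxter equation to zeroth and first order *)

Lemma Rop_Xi2 phi : opeq 2 (opcomp (Rop br) (Xi2 br phi)) (c_phi phi).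
Proof.
move=> [|u [|v []]] // _ W psi psi_lin; rewrite !tev_comp !tev_c_phi.
by rewrite -!tev_comp !Rop_Rinv // !tev_pt.
Qed.

Section ThreeFold.
Variables (W : lmodType k) (psi : seq (X V) -> W).

Lemma tev_op_l_Rop u v w :
  tev psi (op_l (Rop br) [:: u; v; w]) = psi [:: v; u; w] + psi [:: e; B u v; w].
Proof. by rewrite tev_op_l tev_Rop. Qed.

Lemma tev_op_r_Rop u v w :
  tev psi (op_r (Rop br) [:: u; v; w]) = psi [:: u; w; v] + psi [:: u; e; B v w].
Proof. by rewrite tev_op_r tev_Rop. Qed.

Hypothesis psi_lin : multilin psi.

Lemma tev_op_l_Xi2 phi u v w :
  tev psi (op_l (opcomp (Rop br) (Xi2 br phi)) [:: u; v; w]) =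
  psi [:: v; phi u e; w] + psi [:: e; phi u (bar v); w].
Proof. by rewrite tev_op_l Rop_Xi2 ?tev_c_phi //; exact: multilin_catr. Qed.

Lemma tev_op_r_Xi2 phi u v w :
  tev psi (op_r (opcomp (Rop br) (Xi2 br phi)) [:: u; v; w]) =
  psi [:: u; w; phi v e] + psi [:: u; e; phi v (bar w)].
Proof. by rewrite tev_op_r Rop_Xi2 ?tev_c_phi //; exact: multilin_catl. Qed.

End ThreeFold.

Lemma Rop_YBE :
  opeq 3 (opcomp (op_l (Rop br)) (opcomp (op_r (Rop br)) (op_l (Rop br))))
         (opcomp (op_r (Rop br)) (opcomp (op_l (Rop br)) (op_r (Rop br)))).
Proof.
move=> [|u [|v [|w []]]] // _ W psi psi_lin; rewrite !tev_comp.
rewrite ?(tev_op_l_Rop, tev_op_r_Rop) !(brXe, breX, br0X).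
rewrite brX_jacobi (multilinD psi_lin [:: e; e] [::]) /=.
rewrite !(multilin0 psi_lin [:: e] [:: _]) !(multilin0 psi_lin [:: e; _] [::]) /=.
by abel.
Qed.

Lemma Xi2_YBE phi : Z2BSD br phi ->
  YBE_d (Rop br, opcomp (Rop br) (Xi2 br phi)).
Proof.
move=> [phiC phiZ]; split=> /=; first exact: Rop_YBE.
move=> [|u [|v [|w []]]] // _ W psi psi_lin.
have linL := multilin_op_l multilin_op_Rop.
have linR := multilin_op_r multilin_op_Rop.
(* R Ξ²(φ) = c_φ only holds against multilinear maps, so when the perturbed factor acts first, [psi]
   must be pulled back along two copies of R. *)
have linLR := linR _ _ (linL _ _ psi_lin).
have linRL := linL _ _ (linR _ _ psi_lin).
rewrite /opadd !(tev_add, tev_comp).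
rewrite (tev_op_l_Xi2 linLR) (tev_op_r_Xi2 linRL) !tev_op_l_Rop !tev_op_r_Rop.
rewrite ?(tev_op_l_Rop, tev_op_r_Rop, tev_op_l_Xi2 (linR _ _ psi_lin),
  tev_op_r_Xi2 (linL _ _ psi_lin), tev_op_l_Xi2 psi_lin, tev_op_r_Xi2 psi_lin).
rewrite !(brXe, breX, bar_e, cochain0l phiC, cochain0r phiC, br0X, brX0).
rewrite !(tensor_cochain_e phiC) // !(cocycle_brX_e phiC phiZ).
have Be x y : B (phi x e) y = 0.
  by rewrite brX_antisym (brX_cocycle_e phiC phiZ) oppr0.
rewrite (cocycle_bar phiC phiZ u v w) !Be !(brX_cocycle_e phiC phiZ).
rewrite !(multilinD psi_lin [:: e; e] [::]) !(multilinN psi_lin [:: e; e] [::]).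
rewrite !(multilin0 psi_lin [:: _] [:: _]) !(multilin0 psi_lin [:: _; _] [::]) /=.
by rewrite -!/(bar _) /=; abel.
Qed.

Lemma Xi2_cocycle phi : Z2BSD br phi -> Z2YB br (Xi2 br phi).
Proof.
move=> phiZ; split; last exact: Xi2_YBE.
apply/multilin_op_oplin/multilin_op_comp; first exact: multilin_op_Rinv.
exact: multilin_op_c_phi phiZ.1.1.
Qed.

Lemma Xi2_linear a phi psi :
  opeq 2 (Xi2 br (fun u v => a *: phi u v + psi u v))
         (opadd (opscale a (Xi2 br phi)) (Xi2 br psi)).
Proof.
move=> [|u [|v []]] // _ W chi chi_lin.
rewrite tev_add tev_scale !tev_comp.
have H := multilin_op_Rinv chi_lin; rewrite !tev_c_phi.
rewrite (H [:: v] [::]) (H [:: e] [::]) /= scalerDr.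
by rewrite addrACA.
Qed.

(** * Coboundaries on the Yang-Baxter side *)

Lemma multilin_op_leibniz f : lin1 f -> multilin_op (f_id_plus_id_f f).
Proof.
move=> f_lin; apply: multilin_op_word2 => [[|? [|? []]] //|W psi a x y z psi_lin].
have H l r := psi_lin l r a; rewrite !tev_leibniz !f_lin; split.
  by rewrite !(H [::] [:: _]) /= scalerDr addrACA.
by rewrite !(H [:: _] [::]) /= scalerDr addrACA.
Qed.

Definition YB_coboundary f : Op V :=
  opadd (f_id_plus_id_f f)
        (opscale (-1) (opcomp (Rinv br) (opcomp (f_id_plus_id_f f) (Rop br)))).

(* Composing with [R] on the left: [R Xi2 = c_phi], and [R] times the
   coboundary of [f] is the commutator of [R] with [f (x) 1 + 1 (x) f]. *)
Lemma Xi2_coboundaryP phi f : lin1 f ->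
  opeq 2 (Xi2 br phi) (YB_coboundary f) <->
  forall (W : lmodType k) (psi : seq (X V) -> W) u v, multilin psi ->
    psi [:: v; phi u e] + psi [:: e; phi u (bar v)] +
      (psi [:: f e; B u v] + psi [:: e; f (B u v)]) =
    psi [:: e; B (f u) v] + psi [:: e; B u (f v)].
Proof.
move=> f_lin; have linF := multilin_op_leibniz f_lin.
split=> [eq_cob W psi u v psi_lin|eq_psi [|u [|v []]] // _ W psi psi_lin].
  have := eq_cob [:: u; v] erefl _ _ (multilin_op_Rop psi_lin).
  rewrite -tev_comp Rop_Xi2 // tev_c_phi => ->.
  rewrite tev_add tev_scale scaleN1r.
  have -> : tev (fun z => tev psi (Rop br z))
      (opcomp (Rinv br) (opcomp (f_id_plus_id_f f) (Rop br)) [:: u; v]) =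
      tev psi (opcomp (f_id_plus_id_f f) (Rop br) [:: u; v]).
    rewrite !tev_comp !tev_Rop !tev_leibniz.
    by rewrite -!tev_comp !Rop_Rinv // !tev_pt.
  rewrite !tev_comp tev_leibniz !tev_Rop !tev_leibniz.
  by abel.
rewrite tev_add tev_scale scaleN1r !tev_comp.
(* Testing against the pullback of [psi] along [Rinv] undoes the left composition with R. *)
have /= H := eq_psi _ _ u v (multilin_op_Rinv psi_lin).
have -> : tev psi (f_id_plus_id_f f [:: u; v]) =
    tev (fun z => tev psi (Rinv br z)) (opcomp (Rop br) (f_id_plus_id_f f) [:: u; v]).
  rewrite tev_comp !tev_leibniz -!tev_comp.
  by rewrite !Rinv_Rop // !tev_pt.
rewrite tev_c_phi !tev_comp tev_leibniz !tev_Rop !tev_leibniz.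
by move/(canRL (addrK _)): H => ->; abel.
Qed.

Lemma lin1_0 f : lin1 f -> f 0 = 0.
Proof. by move/(_ (-1) 0 0); rewrite scaler0 addr0 scaleN1r addNr. Qed.

Lemma lin1_opp f : lin1 f -> lin1 (fun u => - f u).
Proof. by move=> f_lin a u v; rewrite f_lin opprD scalerN. Qed.

Lemma lin1_bar_decomp f u : lin1 f -> f u = u.1 *: f e + f (bar u).
Proof. by move=> f_lin; rewrite -f_lin -bar_decomp. Qed.

(** * BSD 1-cochains *)

Section OneCochains.
Variable f : X V -> X V.
Hypothesis fC : C1BSD f.

Lemma coderivation1_tev (W : lmodType k) (psi : seq (X V) -> W) u :
  multilin psi ->
  psi [:: e; bar (f u)] =
    psi [:: u; f e] + psi [:: f e; bar u] + psi [:: e; f (bar u)].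
Proof.
move=> psi_lin; have := fC.2 u _ psi psi_lin.
rewrite tev_map !tev_add !tev_pt !tev_add !tev_pt.
by rewrite -!addrA => /addrI ->.
Qed.

Lemma cochain1_fst u : (f u).1 = 0.
Proof.
have key p : bar (f p) = p.1 *: f e + (f e).1 *: bar p + f (bar p).
  by have := coderivation1_tev p multilin_fst_tensor; rewrite /= !scale1r.
have fe0 : (f e).1 = 0.
  have := congr1 fst (key e); rewrite bar_e (lin1_0 fC.1) /=.
  by rewrite !(scale1r, scaler0, addr0) => <-.
have := congr1 fst (key u); rewrite fe0 scale0r addr0 -(lin1_bar_decomp u fC.1).
by move <-.
Qed.

Lemma cochain1_e_dichotomy x y : br x y = 0 \/ f e = 0.
Proof.
have [|fe0] : br x y = 0 \/ (f e).2 = 0; [|by left|].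
  apply: skew_tensor_dichotomy => h h_lin z.
  have := coderivation1_tev ((0 : k^o, z) : X V) (multilin_snd_tensor h_lin).
  by rewrite /= (functional0 h_lin) !scale0r addr0 => <-.
by right; apply: X_eq; rewrite ?cochain1_fst.
Qed.

Lemma brX_cochain1_e u : B u (f e) = 0.
Proof.
have [fe0|->] := cochain1_e_dichotomy u.2 (f e).2; last exact: brX0.
exact: X_eq.
Qed.

Lemma delta1E u v : delta1 br f u v = f (B u v) - B (f u) v - B u (f v).
Proof.
rewrite /delta1 !qXE fC.1 cochain1_fst scale0r add0r.
by abel.
Qed.

End OneCochains.

(** * Comparison of coboundaries and injectivity *)

Lemma Xi2_coboundary phi : B2BSD br phi -> B2YB br (Xi2 br phi).
Proof.
(* The commutator with R produces [f u,v] + [u,f v] - f[u,v], opposite in sign to [delta1E]. *)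
move=> [f [fC phiE]]; exists (fun u => - f u); split; first exact: lin1_opp fC.1.
apply/Xi2_coboundaryP => [|W psi u v psi_lin]; first exact: lin1_opp fC.1.
rewrite !phiE !(delta1E fC) !brXe (lin1_0 fC.1) (brX_cochain1_e fC) !subr0.
have -> : psi [:: - f e; B u v] = 0.
  have [uv0|->] := cochain1_e_dichotomy fC u.2 v.2.
    have -> : B u v = 0 by apply: X_eq.
    exact: (multilin0 psi_lin [:: _] [::]).
  by rewrite oppr0; exact: (multilin0 psi_lin [::] [:: _]).
have -> : B u (- f v) = - B u (f (bar v)).
  by rewrite brXN (lin1_bar_decomp v fC.1) brX_linr (brX_cochain1_e fC) scaler0 add0r.
rewrite brNX !(multilinD psi_lin [:: e] [::]) !(multilinN psi_lin [:: e] [::]).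
rewrite !(multilin0 psi_lin [:: _] [::]) /=.
by abel.
Qed.

Lemma Xi2_injective phi : center_trivial br ->
  Z2BSD br phi -> B2YB br (Xi2 br phi) -> B2BSD br phi.
Proof.
move=> centerless [phiC phiZ] [f [f_lin /(Xi2_coboundaryP phi f_lin) eq_psi]].
pose alpha := (f e).1.
have phiE u v : phi u v = B (f u) v + B u (f v) - f (B u v) - alpha *: B u v.
  have := eq_psi _ _ u v multilin_fst_tensor; rewrite /= !scale1r => <-.
  rewrite (cochain_decompr phiC u v) -/alpha.
  by abel.
have centerX z : z.1 = 0 -> (forall u, B u z = 0) -> z = 0.
  move=> z0 Bz; apply: X_eq => //; apply: centerless => x.
  by rewrite br_antisym; have /(congr1 snd) /= -> := Bz (0, x); rewrite oppr0.
have phi_e u : phi u e = 0.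
  apply: centerX => [|v]; first exact: cochain_fst.
  exact: brX_cocycle_e.
have fe : f e = alpha *: e.
  (* At v = e, [phiE] reads 0 = φ(u,e) = [u, f e], so the Lie part of f(e) is central. *)
  have bar0 : bar (f e) = 0.
    apply: centerX => // u; have := phiE u e.
    by rewrite phi_e !brXe (lin1_0 f_lin) scaler0 !subr0 add0r => /esym.
  by rewrite [LHS]bar_decomp bar0 addr0.
have Bf u v : B (f u) v = B (f (bar u)) v.
  by rewrite (lin1_bar_decomp u f_lin) fe scalerA brX_linl breX scaler0 add0r.
have fB u v : B u (f v) = B u (f (bar v)).
  by rewrite brX_antisym Bf -brX_antisym.
have bar_lin a u v : bar (a *: u + v) = a *: bar u + bar v.
  by apply: X_eq; rewrite //= scaler0 addr0.
(* The BSD coboundary of [alpha *: bar u] is -alpha [u,v], the last term of [phiE]. Both bars make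
   [g] a cochain: it kills [e] and has no scalar part. *)
pose g u := alpha *: bar u - bar (f (bar u)).
have g_lin : lin1 g.
  move=> a u v; rewrite /g !bar_lin f_lin bar_lin scalerDr scalerBr !scalerA.
  by rewrite [alpha * a]mulrC; abel.
have ge : g e = 0 by rewrite /g bar_e (lin1_0 f_lin) scaler0 subrr.
have g_bar u : g (bar u) = g u by [].
have g_fst u : (g u).1 = 0 by rewrite /= scaler0 subr0.
have gC : C1BSD g.
  split=> // u W psi psi_lin.
  rewrite tev_map !tev_add !tev_pt !tev_add !tev_pt -!/(bar _) ge g_bar.
  rewrite (bar_id (g_fst u)) (multilin0 psi_lin [:: u] [::]).
  by rewrite (multilin0 psi_lin [::] [:: _]) /= addr0 add0r.
exists g; split=> // u v; rewrite (delta1E gC).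
have Bg w z : B w (g z) = alpha *: B w z - B w (f z).
  by rewrite /g brX_linr brXN fB.
have gB w z : B (g w) z = alpha *: B w z - B (f w) z.
  by rewrite brX_antisym Bg opprB addrC -brX_antisym (brX_antisym w z) scalerN opprK.
rewrite Bg gB /g.
have barB : bar (B u v) = B u v by [].
(* Barring [phiE] leaves φ unchanged and removes the possible scalar part of f([u,v]). *)
have phi1 := congr1 bar (phiE u v); rewrite (bar_id (cochain_fst phiC u v)) in phi1.
rewrite barB phi1.
have -> : bar (B (f u) v + B u (f v) - f (B u v) - alpha *: B u v) =
    B (f u) v + B u (f v) - bar (f (B u v)) - alpha *: B u v.
  by apply: X_eq; rewrite //= scaler0 !subr0 addr0.
by abel.
Qed.

End BSDComplex.

Theorem mainTheorem15 (k : fieldType) (V : lmodType k) (br : V -> V -> V)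
    (Hlie : is_lie br) :
  [/\ (* Rinv is the (linear) two-sided inverse of R on X (x) X *)
      oplin 2 (Rinv br) /\ opeq 2 (opcomp (Rop br) (Rinv br)) (@opid k V)
        /\ opeq 2 (opcomp (Rinv br) (Rop br)) (@opid k V),
      (* Xi^2 maps Z^2_BSD into Z^2_YB *)
      (forall phi, Z2BSD br phi -> Z2YB br (Xi2 br phi)),
      (* Xi^2 maps B^2_BSD into B^2_YB *)
      (forall phi, B2BSD br phi -> B2YB br (Xi2 br phi)),
      (* Xi^2 is linear, hence induces a homomorphism H^2_BSD -> H^2_YB *)
      (forall (a : k) phi psi,
          opeq 2 (Xi2 br (fun u v => a *: phi u v + psi u v))
                 (opadd (opscale a (Xi2 br phi)) (Xi2 br psi))) &
      (* injectivity when the center is trivial *)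
      (center_trivial br ->
         forall phi, Z2BSD br phi -> B2YB br (Xi2 br phi) -> B2BSD br phi)].
Proof.
split.
- split; first exact/multilin_op_oplin/multilin_op_Rinv.
  by split; [exact: Rop_Rinv | exact: Rinv_Rop].
- exact: Xi2_cocycle.
- exact: Xi2_coboundary.
- exact: Xi2_linear.
- by move=> centerless phi; exact: Xi2_injective.
Qed.
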